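(* Let $\mathcal U:\mathcal S^n\to\mathcal S^n$ be a self-adjoint positive semidefinite linear operator, let $\varepsilon>0$, $\sigma>0$, $\varrho>0$, and let $R_1\in\mathcal S^n$, $R_2\in\mathbb R^m$. Define the linear operators on $\mathcal S^n\times\mathbb R^m$ $$V:=\begin{bmatrix}\mathcal Q&\\&0\end{bmatrix}+\sigma\begin{bmatrix}\mathcal Q\\-\mathcal A\end{bmatrix}\mathcal U\,[\mathcal Q\ \ -\mathcal A^*],\qquad \widehat V:=\begin{bmatrix}\mathcal I&\\&0\end{bmatrix}+\sigma\begin{bmatrix}\mathcal I\\-\mathcal A\end{bmatrix}\mathcal U\,[\mathcal Q\ \ -\mathcal A^*].$$ Suppose $(\widehat{dW},\widehat{dy})\in\mathcal S^n\times\mathbb R^m$ is an approximate solution to the system $\widehat V(dW,dy)+\varrho(0,dy)\approx(R_1,R_2)$ with the residual satisfying $$\|\widehat V(\widehat{dW},\widehat{dy})+\varrho(0,\widehat{dy})-(R_1,R_2)\|\le\frac{\varepsilon}{\max\{\lambda_{\max}(\mathcal Q),1\}}.$$ Let $\widehat{dW}_{\mathcal Q}=\Pi_{{\rm Ran}(\mathcal Q)}(\widehat{dW})\in{\rm Ran}(\mathcal Q)$. Then $(\widehat{dW}_{\mathcal Q},\widehat{dy})$ solves the system $V(dW,dy)+\varrho(0,dy)\approx(\mathcal Q(R_1),R_2)$, $(dW,dy)\in{\rm Ran}(\mathcal Q)\times\mathbb R^m$, with the residual satisfying $$\|V(\widehat{dW}_{\mathcal Q},\widehat{dy})+\varrho(0,\widehat{dy})-(\mathcal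 Q(R_1),R_2)\|\le\varepsilon.$$ Moreover, $\mathcal Q\,\widehat{dW}_{\mathcal Q}=\mathcal Q\,\widehat{dW}$ and $\langle\widehat{dW}_{\mathcal Q},\mathcal Q\,\widehat{dW}_{\mathcal Q}\rangle=\langle\widehat{dW},\mathcal Q\,\widehat{dW}\rangle$.
   Context: $\mathcal S^n$ is the space of real symmetric $n\times n$ matrices with trace inner product $\langle\cdot,\cdot\rangle$ and Frobenius norm $\|\cdot\|$; $\mathcal S^n\times\mathbb R^m$ carries the product inner product and induced norm. $\mathcal Q:\mathcal S^n\to\mathcal S^n$ is a self-adjoint positive semidefinite linear operator with largest eigenvalue $\lambda_{\max}(\mathcal Q)$ and range ${\rm Ran}(\mathcal Q)$; $\mathcal A:\mathcal S^n\to\mathbb R^m$ is linear with adjoint $\mathcal A^*$; $\mathcal I$ is the identity operator; $\Pi_{{\rm Ran}(\mathcal Q)}$ is the orthogonal projection onto ${\rm Ran}(\mathcal Q)$. In block notation, $[\mathcal Q\ \ -\mathcal A^*](W,y)=\mathcal QW-\mathcal A^*y$. *)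

(* Defs.v *)
From HB Require Import structures.
From mathcomp Require Import all_boot all_order all_algebra.
From mathcomp Require Import boolp classical_sets reals.

Set Implicit Arguments.
Unset Strict Implicit.
Unset Printing Implicit Defensive.

Import Order.TTheory GRing.Theory Num.Theory.
Local Open Scope ring_scope.

(* S^n, as a finite-dimensional vector space over R. *)
Definition symv (R : realType) (n : nat) : {vspace 'M[R]_n} :=
  fixedSpace (linfun trmx).

Lemma memv_symv (R : realType) (n : nat) (X : 'M[R]_n) :
  (X \in symv R n) = (X^T == X).
Proof. by apply/fixedSpaceP/eqP; rewrite lfunE. Qed.

Notation "''Sym[' R ]_ n" := (subvs_of (symv R n))
  (at level 8, n at level 2, format "''Sym[' R ]_ n").

(* <X, Y> = tr (X^T Y): the trace inner product tr (X Y) on symmetric matrices,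
   and the standard inner product on column vectors. *)
Definition mxdot (R : realType) (m n : nat) (X Y : 'M[R]_(m, n)) : R :=
  \tr (X^T *m Y).

(* The codomain is R^o so that [symdot X] is a vector-space morphism. *)
Definition symdot (R : realType) (n : nat) (X Y : 'Sym[R]_n) : R^o :=
  mxdot (vsval X) (vsval Y).

Fact symdot_is_linear (R : realType) (n : nat) (X : 'Sym[R]_n) :
  linear (symdot X).
Proof.
move=> a Y Z; rewrite /symdot /mxdot.
have -> : vsval (a *: Y + Z) = a *: vsval Y + vsval Z by rewrite linearP.
by rewrite mulmxDr -scalemxAr linearP.
Qed.

HB.instance Definition _ (R : realType) (n : nat) (X : 'Sym[R]_n) :=
  GRing.isLinear.Build R 'Sym[R]_n R^o _ (symdot X) (symdot_is_linear X).

(* MathComp-Analysis puts the max norm on products, hence the explicit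
   product inner product here. *)
Definition pairdot (R : realType) (n m : nat)
    (p q : 'Sym[R]_n * 'cV[R]_m) : R :=
  symdot p.1 q.1 + mxdot p.2 q.2.

Definition pairnorm (R : realType) (n m : nat)
    (p : 'Sym[R]_n * 'cV[R]_m) : R :=
  Num.sqrt (pairdot p p).

Definition self_adjoint (R : realType) (n : nat) (Q : 'End('Sym[R]_n)) : Prop :=
  forall X Y, symdot (Q X) Y = symdot X (Q Y).

Definition psd (R : realType) (n : nat) (Q : 'End('Sym[R]_n)) : Prop :=
  forall X, 0 <= symdot X (Q X).

(* As = A^*. *)
Definition is_adjoint (R : realType) (n m : nat)
    (A : 'Hom('Sym[R]_n, 'cV[R]_m)) (As : 'Hom('cV[R]_m, 'Sym[R]_n)) : Prop :=
  forall X y, mxdot (A X) y = symdot X (As y).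

(* A linear operator has finitely many eigenvalues, so the supremum is a maximum
   as soon as there is one (for Q self-adjoint: as soon as n > 0).  For n = 0
   there is no eigenvalue and lambda_max Q = 0. *)
Definition lambda_max (R : realType) (n : nat) (Q : 'End('Sym[R]_n)) : R :=
  sup [set a | passmx.leigenvalue Q a]%classic.

Lemma lambda_maxE (R : realType) (n : nat) (Q : 'End('Sym[R]_n)) (a : R) :
  passmx.leigenvalue Q a -> (forall b, passmx.leigenvalue Q b -> b <= a) -> lambda_max Q = a.
Proof.
move=> Qa leQa; apply/eqP; rewrite eq_le; apply/andP; split.
  by apply: ge_sup; first by exists a.
by apply: ub_le_sup => //; exists a.
Qed.

(* The orthogonal complement of U. *)
Definition orthov (R : realType) (n : nat) (U : {vspace 'Sym[R]_n}) :
    {vspace 'Sym[R]_n} :=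
  (\bigcap_(X <- vbasis U) lker (linfun (symdot X)))%VS.

Lemma orthovP (R : realType) (n : nat) (U : {vspace 'Sym[R]_n})
    (Y : 'Sym[R]_n) :
  (forall X, X \in U -> symdot X Y = 0) <-> Y \in orthov U.
Proof.
have symdotC (X Z : 'Sym[R]_n) : symdot X Z = symdot Z X.
  by rewrite /symdot /mxdot -mxtrace_tr trmx_mul trmxK.
rewrite /orthov big_tnth; split=> [UY | /subv_bigcapP UY X UX].
  apply/subv_bigcapP => i _; rewrite -memvE memv_ker lfunE /=.
  by rewrite UY // vbasis_mem // mem_tnth.
rewrite symdotC (coord_vbasis UX) linear_sum big1 // => i _.
have {}UY Z : Z \in (vbasis U : seq _) -> symdot Y Z = 0.
  move=> /seq_tnthP[j ->]; have := UY j isT.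
  by rewrite -memvE memv_ker lfunE /= symdotC => /eqP.
by rewrite linearZ /= UY ?scaler0 // mem_nth // size_tuple.
Qed.

(* Pi_U, as the projection onto U along its orthogonal complement. *)
Definition orthoproj (R : realType) (n : nat) (U : {vspace 'Sym[R]_n}) :
    'End('Sym[R]_n) :=
  daddv_pi U (orthov U).

(* The block row [Q  -A^*], with As = A^*. *)
Definition block_row (R : realType) (n m : nat) (Q : 'End('Sym[R]_n))
    (As : 'Hom('cV[R]_m, 'Sym[R]_n)) (p : 'Sym[R]_n * 'cV[R]_m) : 'Sym[R]_n :=
  Q p.1 - As p.2.

(* The block column [B; -A]. *)
Definition block_col (R : realType) (n m : nat) (B : 'End('Sym[R]_n))
    (A : 'Hom('Sym[R]_n, 'cV[R]_m)) (Z : 'Sym[R]_n) : 'Sym[R]_n * 'cV[R]_m :=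
  (B Z, - A Z).

Definition opV (R : realType) (n m : nat) (Q U : 'End('Sym[R]_n))
    (A : 'Hom('Sym[R]_n, 'cV[R]_m)) (As : 'Hom('cV[R]_m, 'Sym[R]_n))
    (sigma : R) (p : 'Sym[R]_n * 'cV[R]_m) : 'Sym[R]_n * 'cV[R]_m :=
  (Q p.1, 0) + sigma *: block_col Q A (U (block_row Q As p)).

Definition opVhat (R : realType) (n m : nat) (Q U : 'End('Sym[R]_n))
    (A : 'Hom('Sym[R]_n, 'cV[R]_m)) (As : 'Hom('cV[R]_m, 'Sym[R]_n))
    (sigma : R) (p : 'Sym[R]_n * 'cV[R]_m) : 'Sym[R]_n * 'cV[R]_m :=
  (p.1, 0) + sigma *: block_col \1%VF A (U (block_row Q As p)).

(* Main.v *)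
(** Since Q is self-adjoint, the orthogonal complement of Ran(Q) is Ker(Q), so
    projecting onto Ran(Q) does not change Q dW.  Hence the map
    (r1, r2) |-> (Q r1, r2) turns the residual of the hatted system
    into that of the projected one, and |Q r1| <= lambda_max(Q) |r1| gives the
    bound.  The operator-norm inequality is obtained without diagonalizing: the
    supremum of the Rayleigh quotient of Q is shown to be an eigenvalue. *)

Require Import Defs.
From mathcomp Require Import all_boot all_order all_algebra.
From mathcomp Require Import boolp classical_sets reals.
From mathcomp Require Import ring lra.

Import Order.TTheory GRing.Theory Num.Theory.
Local Open Scope ring_scope.

Section Dot.
Set Implicit Arguments.
Unset Strict Implicit.
Context {R : realType}.

(** * Elementary properties of the trace inner product *)

Lemma mxdot_sum {m n} (X Y : 'M[R]_(m, n)) :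
  mxdot X Y = \sum_i \sum_j X i j * Y i j.
Proof.
rewrite /mxdot /mxtrace exchange_big; apply: eq_bigr => j _ /=.
by rewrite mxE; apply: eq_bigr => i _; rewrite mxE.
Qed.

Lemma mxdot_ge0 {m n} (X : 'M[R]_(m, n)) : 0 <= mxdot X X.
Proof.
by rewrite mxdot_sum; do 2!(apply: sumr_ge0 => ? _); rewrite -expr2 sqr_ge0.
Qed.

Lemma sqr_entry_le_mxdot {m n} (X : 'M[R]_(m, n)) i j : X i j ^+ 2 <= mxdot X X.
Proof.
have sq_ge0 k l : 0 <= X k l * X k l by rewrite -expr2 sqr_ge0.
rewrite mxdot_sum (bigD1 i) //= (bigD1 j) //= -expr2 -addrA lerDl addr_ge0 //.
  by apply: sumr_ge0.
by do 2!(apply: sumr_ge0 => ? _).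
Qed.

Context {n : nat}.
Implicit Types (X Y Z : 'Sym[R]_n) (F M Q : 'End('Sym[R]_n)).

Lemma symdotC X Y : symdot X Y = symdot Y X.
Proof. by rewrite /symdot /mxdot -mxtrace_tr trmx_mul trmxK. Qed.

Lemma symdotDr X Y Z : symdot X (Y + Z) = symdot X Y + symdot X Z.
Proof. exact: linearD. Qed.

Lemma symdotZr (a : R) X Y : symdot X (a *: Y) = a * symdot X Y.
Proof. exact: linearZ. Qed.

Lemma symdotDl X Y Z : symdot (X + Y) Z = symdot X Z + symdot Y Z.
Proof. by rewrite symdotC symdotDr !(symdotC Z). Qed.

Lemma symdotZl (a : R) X Y : symdot (a *: X) Y = a * symdot X Y.
Proof. by rewrite symdotC symdotZr symdotC. Qed.

Lemma symdot0r X : symdot X 0 = 0.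
Proof. exact: linear0. Qed.

Lemma symdot_ge0 X : 0 <= symdot X X.
Proof. exact: mxdot_ge0. Qed.

Lemma symdot_eq0 X : (symdot X X == 0) = (X == 0).
Proof.
apply/eqP/eqP => [XX0|->]; last exact: symdot0r.
apply/val_inj/matrixP => i j; have := sqr_entry_le_mxdot (vsval X) i j.
rewrite -[mxdot _ _]/(symdot X X) XX0 => Xij_le0; rewrite linear0 mxE.
by apply/eqP; rewrite -sqrf_eq0 eq_le Xij_le0 sqr_ge0.
Qed.

Lemma symdot_gt0 X : X != 0 -> 0 < symdot X X.
Proof. by move=> X0; rewrite lt_def symdot_eq0 X0 symdot_ge0. Qed.

Lemma symdot_le_half X Y : symdot X Y *+ 2 <= symdot X X + symdot Y Y.
Proof.
have := symdot_ge0 (X + (-1 : R) *: Y).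
rewrite symdotDr !symdotDl !symdotZr !symdotZl (symdotC Y X).
move: (symdot X X) (symdot X Y) (symdot Y Y) => a b c /=.
by lra.
Qed.

Lemma symdotDD_le X Y :
  symdot (X + Y) (X + Y) <= symdot X X *+ 2 + symdot Y Y *+ 2.
Proof.
have := symdot_le_half X Y; rewrite symdotDr !symdotDl (symdotC Y X).
move: (symdot X X) (symdot X Y) (symdot Y Y) => a b c /=.
by lra.
Qed.

(** * Boundedness of linear operators and semidefinite forms *)

Lemma bounded_sum {I : Type} (s : seq I) (f : I -> 'Sym[R]_n -> 'Sym[R]_n) :
  (forall i, exists2 K : R, 0 <= K &
     forall X, symdot (f i X) (f i X) <= K * symdot X X) ->
  exists2 K : R, 0 <= K & forall X,
    symdot (\sum_(i <- s) f i X) (\sum_(i <- s) f i X) <= K * symdot X X.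
Proof.
move=> fb; elim: s => [|i s [K K0 Kb]].
  by exists 0 => // X; rewrite !big_nil symdot0r mul0r.
have [L L0 Lb] := fb i; exists (L *+ 2 + K *+ 2); first by lra.
move=> X; rewrite !big_cons (le_trans (symdotDD_le _ _)) //.
by rewrite mulrDl !mulrnAl lerD // lerMn2r // ?Lb ?Kb.
Qed.

(** Expand [X] over the elementary matrices: each coefficient is an entry of [X], bounded by its
    norm. *)
Lemma End_bounded F : exists2 K : R, 0 <= K &
  forall X, symdot (F X) (F X) <= K * symdot X X.
Proof.
(* [delta_mx] is not symmetric off the diagonal, hence [vsproj]; by linearity the projected
   expansion still sums to [X]. *)
pose E (p : 'I_n * 'I_n) := F (vsproj (symv R n) (delta_mx p.1 p.2)).
have FE X : F X = \sum_p vsval X p.1 p.2 *: E p.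
  rewrite -[in LHS](vsvalK X) [in LHS](matrix_sum_delta (vsval X)).
  rewrite pair_bigA /= !linear_sum; apply: eq_bigr => p _.
  by rewrite !linearZ.
have [p|K K0 Kb] := bounded_sum (index_enum _)
  (f := fun (p : 'I_n * 'I_n) X => vsval X p.1 p.2 *: E p).
  exists (symdot (E p) (E p)); first exact: symdot_ge0.
  move=> X; rewrite symdotZl symdotZr mulrA -expr2 mulrC.
  by rewrite ler_wpM2l ?symdot_ge0 // sqr_entry_le_mxdot.
by exists K => // X; rewrite FE.
Qed.

Lemma Rayleigh_bounded F : exists2 K : R, 0 <= K &
  forall X, symdot X (F X) <= K * symdot X X.
Proof.
have [K K0 Kb] := End_bounded F; exists (1 + K); first by rewrite addr_ge0.
move=> X; have := Kb X; have := symdot_le_half X (F X).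
have := symdot_ge0 X.
move: (symdot X X) (symdot X (F X)) (symdot (F X) (F X)) => a b c /=.
move=> *; have : 0 <= K * a by rewrite mulr_ge0.
lra.
Qed.

(** The discriminant argument for the form at [X + t *: Y], a nonnegative quadratic in [t]. *)
Lemma psd_CauchySchwarz M X Y : self_adjoint M -> psd M ->
  symdot X (M Y) ^+ 2 <= symdot X (M X) * symdot Y (M Y).
Proof.
move=> Msa Mpsd.
have quad (t : R) : 0 <= symdot X (M X) + t * symdot X (M Y) *+ 2
                         + t ^+ 2 * symdot Y (M Y).
  have := Mpsd (X + t *: Y).
  rewrite linearD linearZ /= !symdotDl !symdotDr !symdotZl !symdotZr.
  rewrite (symdotC Y (M X)) Msa.
  move: (symdot X (M X)) (symdot X (M Y)) (symdot Y (M Y)) => a b c.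
  by move=> /le_trans; apply; rewrite le_eqVlt; apply/predU1P; left; ring.
have := Mpsd Y; move: quad.
move: (symdot X (M X)) (symdot X (M Y)) (symdot Y (M Y)) => a b c.
move=> quad c0.
have [c_eq0|c_neq0] := eqVneq c 0.
  have [->|b0] := eqVneq b 0; first by rewrite c_eq0 mulr0 expr0n.
  (* With [c = 0] the quadratic is affine in [t]; this [t] would give it the value -1. *)
  have := quad (- (a + 1) / (b *+ 2)).
  have -> : - (a + 1) / (b *+ 2) * b *+ 2 = - (a + 1) by field.
  by rewrite c_eq0 mulr0; lra.
have {c0} c_gt0 : 0 < c by rewrite lt_def c_neq0.
(* [t = - b / c] is the minimizer. *)
have := mulr_ge0 (ltW c_gt0) (quad (- b / c)).
have -> : c * (a + - b / c * b *+ 2 + (- b / c) ^+ 2 * c) = a * c - b ^+ 2.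
  by field.
by rewrite subr_ge0.
Qed.

(* Cauchy-Schwarz for the form <X, M Y>, applied to the pair (M X, X). *)
Lemma psd_image_le M (c : R) : self_adjoint M -> psd M ->
  (forall X, symdot X (M X) <= c * symdot X X) ->
  forall X, symdot (M X) (M X) <= c * symdot X (M X).
Proof.
move=> Msa Mpsd Mc X; have [MX0|MX0] := eqVneq (M X) 0.
  by rewrite MX0 !symdot0r mulr0.
rewrite -(ler_pM2l (symdot_gt0 MX0)) -expr2.
apply: le_trans (psd_CauchySchwarz (M X) X Msa Mpsd) _.
by rewrite mulrCA mulrA ler_wpM2r // Mc.
Qed.

(** * The largest eigenvalue as the supremum of the Rayleigh quotient *)

Lemma leigenvalueP Q (a : R) :
  reflect (exists2 X, X != 0 & Q X = a *: X) (passmx.leigenvalue Q a).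
Proof.
rewrite /passmx.leigenvalue /passmx.leigenspace.
apply: (iffP idP) => [ker0|[X X0 QX]].
  exists (vpick (lker (Q - a *: \1%VF))); first by rewrite vpick0.
  have := memv_pick (lker (Q - a *: \1%VF)).
  by rewrite memv_ker add_lfunE opp_lfunE scale_lfunE id_lfunE subr_eq0 => /eqP.
apply: contraNneq X0 => ker0; rewrite -memv0 -ker0 memv_ker.
by rewrite add_lfunE opp_lfunE scale_lfunE id_lfunE QX subrr.
Qed.

(* Were s - Q injective, s the supremum of the Rayleigh quotient, it would be
   bounded below by a positive multiple of the identity, and s could be
   decreased. *)
Lemma Rayleigh_le_lambda_max Q : self_adjoint Q -> psd Q ->
  forall X, symdot X (Q X) <= lambda_max Q * symdot X X.
Proof.
move=> Qsa Qpsd X; have [->|X0] := eqVneq X 0.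
  by rewrite linear0 !symdot0r mulr0.
(* [B] collects the upper bounds of the Rayleigh quotient, so its infimum [s] is the supremum of
   that quotient. *)
pose B : set R :=
  [set c | forall Y, symdot Y (Q Y) <= c * symdot Y Y]%classic.
pose s := inf B.
have lbB Y : Y != 0 -> lbound B (symdot Y (Q Y) / symdot Y Y).
  by move=> Y0 c /(_ Y); rewrite ler_pdivrMr ?symdot_gt0.
have hlB : has_lbound B by exists (symdot X (Q X) / symdot X X); exact: lbB.
have Bs : B s.
  move=> Y; have [->|Y0] := eqVneq Y 0; first by rewrite linear0 !symdot0r mulr0.
  rewrite -ler_pdivrMr ?symdot_gt0 //; apply: lb_le_inf; last exact: lbB.
  by have [K _ KQ] := Rayleigh_bounded Q; exists K.
(* Every eigenvalue is the Rayleigh quotient of its eigenvector, hence at most [s]; so [s] only has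
   to be an eigenvalue. *)
suff s_eig : passmx.leigenvalue Q s.
  rewrite (lambda_maxE s_eig) // => b /leigenvalueP[Y Y0 QY].
  by have := Bs Y; rewrite QY symdotZr ler_pM2r ?symdot_gt0.
pose M := s *: \1%VF - Q; have ME Y : M Y = s *: Y - Q Y.
  by rewrite add_lfunE opp_lfunE scale_lfunE id_lfunE.
have symM Y Z : symdot Y (M Z) = s * symdot Y Z - symdot Y (Q Z).
  by rewrite ME -scaleN1r symdotDr !symdotZr mulN1r.
have Msa : self_adjoint M.
  by move=> Y Z; rewrite symdotC !symM (symdotC Z Y) -Qsa (symdotC (Q Z)).
have Mpsd : psd M by move=> Y; rewrite symM subr_ge0.
apply: contrapT => s_neig; have kerM : lker M == 0%VS.
  apply/eqP/vspaceP => Y; rewrite memv_ker memv0 ME subr_eq0 eq_sym.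
  apply/eqP/eqP => [QY|->]; last by rewrite linear0 scaler0.
  by apply: contrapT => /eqP Y0; apply: s_neig; apply/leigenvalueP; exists Y.
have [K K0 KM] := Rayleigh_bounded M.
have [L L0 LM] := End_bounded M^-1%VF.
(* Writing [Y] as the inverse of [M] applied to [M Y] gives [|Y|^2 <= L |M Y|^2 <= L K <Y, M Y>].
   The added 1 makes the constant positive, hence invertible. *)
have coercive Y : symdot Y Y <= (L * K + 1) * symdot Y (M Y).
  rewrite -[X in symdot X X](lker0_lfunK kerM Y) (le_trans (LM _)) //.
  rewrite mulrDl mul1r -[leLHS]addr0 lerD // -mulrA ler_wpM2l //.
  exact: psd_image_le.
have C_gt0 : 0 < L * K + 1 by rewrite ltr_wpDl ?mulr_ge0.
have Bs' : B (s - (L * K + 1)^-1).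
  move=> Y; rewrite mulrBl lerBrDr -lerBrDl -symM mulrC ler_pdivrMr // mulrC.
  exact: coercive.
by have := ge_inf hlB Bs'; rewrite leNgt gtrBl invr_gt0 C_gt0.
Qed.

Lemma lambda_max_ge0 Q : self_adjoint Q -> psd Q -> forall X, X != 0 ->
  0 <= lambda_max Q.
Proof.
move=> Qsa Qpsd X X0; rewrite -(pmulr_lge0 _ (symdot_gt0 X0)).
exact: le_trans (Qpsd X) (Rayleigh_le_lambda_max Qsa Qpsd X).
Qed.

(** One factor [lambda_max Q] comes from [|Q X|^2 <= lambda_max Q <X, Q X>], the other from the
    Rayleigh bound. *)
Lemma symdot_image_le Q : self_adjoint Q -> psd Q ->
  forall X, symdot (Q X) (Q X) <= lambda_max Q ^+ 2 * symdot X X.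
Proof.
move=> Qsa Qpsd X; have [->|X0] := eqVneq X 0.
  by rewrite linear0 !symdot0r mulr0.
have Qle := Rayleigh_le_lambda_max Qsa Qpsd.
rewrite expr2 -mulrA (le_trans (psd_image_le Qsa Qpsd Qle X)) //.
by rewrite ler_wpM2l // (lambda_max_ge0 Qsa Qpsd X0).
Qed.

(** * Orthogonal projection onto the range *)

Lemma orthov_limg Q : self_adjoint Q -> Defs.orthov (limg Q) = lker Q.
Proof.
move=> Qsa; apply/vspaceP => X; rewrite memv_ker; apply/idP/eqP => [|QX0].
  move=> /Defs.orthovP oX; apply/eqP; rewrite -symdot_eq0 Qsa symdotC.
  by rewrite oX // memv_img ?memvf.
by apply/Defs.orthovP => _ /memv_imgP[Y _ ->]; rewrite Qsa QX0 symdot0r.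
Qed.

Lemma orthoproj_limgE Q X : self_adjoint Q -> Q (orthoproj (limg Q) X) = Q X.
Proof.
(* If [Q Z] lies in the kernel, then [|Q Z|^2 = <Z, Q (Q Z)> = 0]. Rank-nullity then makes the
   direct sum the whole space, so [X] is the sum of its two projections. *)
move=> Qsa; have dx : (limg Q :&: lker Q)%VS = 0%VS.
  apply/eqP; rewrite -subv0; apply/subvP => Y; rewrite memv_cap memv_ker memv0.
  case/andP=> /memv_imgP[Z _ ->] /eqP QQZ.
  by rewrite -symdot_eq0 Qsa QQZ symdot0r.
have full : (limg Q + lker Q)%VS = fullv.
  apply/eqP; rewrite eqEdim subvf dimv_disjoint_sum // addnC.
  by rewrite -(limg_ker_dim Q fullv) capfv leqnn.
rewrite /orthoproj orthov_limg // -{2}(daddv_pi_add (w := X) dx) ?full ?memvf //.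
have := memv_pi (lker Q) (limg Q) X; rewrite memv_ker => /eqP QX0.
by rewrite linearD /= QX0 addr0.
Qed.

End Dot.

Theorem proposition4p2 (R : realType) (n m : nat)
    (Q : 'End('Sym[R]_n)) (Q_sa : self_adjoint Q) (Q_psd : psd Q)
    (A : 'Hom('Sym[R]_n, 'cV[R]_m)) (As : 'Hom('cV[R]_m, 'Sym[R]_n))
    (A_adj : is_adjoint A As)
    (U : 'End('Sym[R]_n)) (U_sa : self_adjoint U) (U_psd : psd U)
    (eps sigma rho : R) (eps_gt0 : 0 < eps) (sigma_gt0 : 0 < sigma)
    (rho_gt0 : 0 < rho)
    (R1 : 'Sym[R]_n) (R2 : 'cV[R]_m)
    (dW : 'Sym[R]_n) (dy : 'cV[R]_m)
    (residual : pairnorm (opVhat Q U A As sigma (dW, dy)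
                          + rho *: (0, dy) - (R1, R2))
                <= eps / Num.max (lambda_max Q) 1) :
  let dWQ := orthoproj (limg Q) dW in
  [/\ dWQ \in limg Q,
      pairnorm (opV Q U A As sigma (dWQ, dy) + rho *: (0, dy) - (Q R1, R2))
        <= eps,
      Q dWQ = Q dW
    & symdot dWQ (Q dWQ) = symdot dW (Q dW)].
Proof.
move=> dWQ; have QdWQ : Q dWQ = Q dW by exact: orthoproj_limgE.
split=> //; first exact: memv_pi.
  pose r := opVhat Q U A As sigma (dW, dy) + rho *: (0, dy) - (R1, R2).
  have -> : opV Q U A As sigma (dWQ, dy) + rho *: (0, dy) - (Q R1, R2)
            = (Q r.1, r.2).
    (* Both systems see the matrix variable through [Q] alone, except for the leading [dW] of the
       hatted one, which [Q] maps to [Q dW]. *)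
    rewrite /opV /block_row /= QdWQ; congr (_, _) => /=.
    have QE X Y Z : Q (X + sigma *: Y - Z) = Q X + sigma *: Q Y - Q Z.
      by rewrite linearB linearD linearZ.
    by rewrite /block_row id_lfunE !scaler0 !addr0 QE.
  move: residual; rewrite -/r; clearbody r => residual.
  pose k := Num.max (lambda_max Q) 1.
  have k_ge1 : 1 <= k by rewrite le_max lexx orbT.
  have k_gt0 : 0 < k by exact: lt_le_trans ltr01 k_ge1.
  move: residual; rewrite -/k ler_pdivlMr // => /(le_trans _); apply.
  (* Writing [k] as the root of [k ^+ 2] reduces the claim to squared norms, component by component:
     [k >= 1] serves the second, [k >= lambda_max Q] the first. *)
  rewrite mulrC -[k in leRHS]ger0_norm ?(ltW k_gt0) // -sqrtr_sqr.
  rewrite /pairnorm -sqrtrM ?sqr_ge0 // ler_wsqrtr // /pairdot mulrDr /=.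
  rewrite lerD //; last first.
    by rewrite ler_peMl ?mxdot_ge0 // exprn_ege1.
  (* A nonzero [r.1] supplies [0 <= lambda_max Q], used to square [lambda_max Q <= k]. *)
  have [->|r0] := eqVneq r.1 0; first by rewrite linear0 !symdot0r mulr0.
  apply: le_trans (symdot_image_le Q_sa Q_psd _) _.
  rewrite ler_wpM2r ?symdot_ge0 // ler_pXn2r ?nnegrE ?(ltW k_gt0) //.
    by rewrite le_max lexx.
  exact: lambda_max_ge0 r0.
(* Self-adjointness moves [Q] onto the remaining [dWQ], where it can again be replaced by [dW]. *)
by rewrite QdWQ -Q_sa QdWQ Q_sa.
Qed.
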